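(* Let $N$ be a positive integer, let $a=1$ and $b=\lfloor\sqrt{N}\rfloor-1$. Then $$f(N,a,b)=\frac{\sqrt{(\lfloor\sqrt{N}\rfloor-1)^2+1}}{\sqrt{N}}.$$
   Context: For integers $N\ge1$ and $a,b$, the modular lattice is $L_{N,a,b}=\{(na \bmod N,\ nb \bmod N):0\le n<N\}$, and $\lambda(L_{N,a,b})$ denotes the length of a shortest non-zero vector of the lattice $L((a,b),(N,0),(0,N))$ of all integer linear combinations of $(a,b),(N,0),(0,N)$ (equivalently, the shortest distance between points of $L_{N,a,b}$ taken modulo $N$). Define $f(N,a,b)=\lambda(L_{N,a,b})/\sqrt{N}$. *)

(* Defs.v *)
From HB Require Import structures.
From mathcomp Require Import all_boot all_order all_algebra.
From mathcomp Require Import boolp classical_sets reals.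

Set Implicit Arguments.
Unset Strict Implicit.
Unset Printing Implicit Defensive.

Import Order.TTheory GRing.Theory Num.Theory.
Local Open Scope classical_set_scope.
Local Open Scope ring_scope.

Section Lattice.
Variable R : realType.
Implicit Types (L : set (int * int)) (v w : int * int).

Definition euclidean_length v : R :=
  Num.sqrt ((v.1)%:~R ^+ 2 + (v.2)%:~R ^+ 2).

Definition shortest_vectors L : set (int * int) :=
  [set v | [/\ L v, v != 0 &
    forall w, L w -> w != 0 -> euclidean_length v <= euclidean_length w]].

(* The value does not depend on which shortest vector is picked
   ([shortest_lengthE]); it is 0 only when [L] has no non-zero vector
   ([shortest_vectors_neq0]). *)
Definition shortest_length L : R :=
  euclidean_length (xget 0 (shortest_vectors L)).

Definition modular_lattice (N : nat) (a b : int) : set (int * int) :=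
  [set p | exists2 n : nat, (n < N)%N &
    p = ((n%:Z * a %% N%:Z)%Z, (n%:Z * b %% N%:Z)%Z)].

(* The lattice whose shortest vectors measure [modular_lattice N a b]: it
   consists of the integer points that reduce modulo [N] to a point of
   [modular_lattice N a b] ([periodic_latticeE]). *)
Definition periodic_lattice (N : nat) (a b : int) : set (int * int) :=
  [set v | inIntSpan [tuple (a, b); (N%:Z, 0); (0, N%:Z)] v].

Definition f (N : nat) (a b : int) : R :=
  shortest_length (periodic_lattice N a b) / Num.sqrt N%:R.

Lemma shortest_lengthE L v :
  shortest_vectors L v -> shortest_length L = euclidean_length v.
Proof.
move=> Lv; rewrite /shortest_length.
have [Lx x0 lex] := xgetI 0 Lv; have [Lv' v0 lev] := Lv.
by apply/eqP; rewrite eq_le lex //= lev.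
Qed.

Lemma shortest_vectors_neq0 L :
  (exists2 v, L v & v != 0) -> exists v, shortest_vectors L v.
Proof.
case=> v0 Lv0 v0_neq0.
pose sq v := (`|v.1| ^ 2 + `|v.2| ^ 2)%N.
have lengthE v : euclidean_length v = Num.sqrt (sq v)%:R.
  by rewrite /euclidean_length /sq natrD !natrX !natr_absz !intr_norm
    !real_normK ?num_real.
pose P n := `[< exists v, [/\ L v, v != 0 & sq v = n] >].
have exP : exists n, P n by exists (sq v0); apply/asboolP; exists v0.
have [n /asboolP[v [Lv v_neq0 sqv]] min_n] := ex_minnP exP.
exists v; split=> // w Lw w_neq0.
rewrite !lengthE ler_wsqrtr // ler_nat sqv.
by apply: min_n; apply/asboolP; exists w.
Qed.

Lemma periodic_latticeP N a b v :
  periodic_lattice N a b v <->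
  exists n k l : int, v = (n * a + k * N%:Z, n * b + l * N%:Z).
Proof.
have mulE (w : int * int) m : w *~ m = (m * w.1, m * w.2).
  apply: injective_projections => /=.
    by rewrite (raddfMz fst) -mulrzr mulrC intz.
  by rewrite (raddfMz snd) -mulrzr mulrC intz.
have sumE (c : int ^ 3) : \sum_(i < 3)
    [tuple (a, b); (N%:Z, 0); (0, N%:Z)]`_i *~ c i =
    (c ord0 * a + c (lift ord0 ord0) * N%:Z,
     c ord0 * b + c (lift ord0 (lift ord0 ord0)) * N%:Z).
  rewrite !big_ord_recl big_ord0 addr0 !mulE /= !mulr0.
  by apply: injective_projections; rewrite /= ?addr0 ?add0r.
split=> [[c ->]|[n [k [l ->]]]].
  by rewrite sumE; do 3!eexists.
by exists [ffun i : 'I_3 => [:: n; k; l]`_i]; rewrite sumE !ffunE.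
Qed.

Lemma periodic_latticeE N a b v : (0 < N)%N ->
  periodic_lattice N a b v <->
  modular_lattice N a b ((v.1 %% N%:Z)%Z, (v.2 %% N%:Z)%Z).
Proof.
move=> N_gt0; have N_neq0 : N%:Z != 0 by rewrite -lt0n.
split=> [/periodic_latticeP[n [k [l ->]]]|[n _ [v1E v2E]]].
  exists `|(n %% N%:Z)%Z|%N.
    by rewrite -ltz_nat gez0_abs ?modz_ge0 ?ltz_pmod.
  by rewrite gez0_abs ?modz_ge0 //= !modzMml ![_ + _ * N%:Z]addrC !modzMDl.
apply/periodic_latticeP.
exists n, ((v.1 %/ N%:Z)%Z - (n%:Z * a %/ N%:Z)%Z),
  ((v.2 %/ N%:Z)%Z - (n%:Z * b %/ N%:Z)%Z).
apply: injective_projections => /=.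
  by rewrite mulrBl addrCA {1}(divz_eq v.1 N%:Z) v1E /modz.
by rewrite mulrBl addrCA {1}(divz_eq v.2 N%:Z) v2E /modz.
Qed.

End Lattice.

(* Main.v *)
(* A lattice vector [(x, y)] satisfies [b * x - y = m * N] for some integer
   [m].  If [m = 0] it is a non-zero multiple of [(1, b)]; otherwise
   Cauchy-Schwarz against [(b, -1)] gives
   [(b ^ 2 + 1) * (x ^ 2 + y ^ 2) >= N ^ 2 >= (b ^ 2 + 1) ^ 2].  So [(1, b)] is
   a shortest vector as soon as [b ^ 2 + 1 <= N], and this holds for
   [b = s - 1] with [1 <= s] and [s ^ 2 <= N]. *)
Require Import Defs.
From mathcomp Require Import all_boot all_order all_algebra.
From mathcomp Require Import reals.
From mathcomp Require Import ring zify.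
Import Order.TTheory GRing.Theory Num.Theory.
Local Open Scope ring_scope.

Lemma periodic_lattice_sqr_ge (N : nat) (b x y : int) :
  b ^+ 2 + 1 <= N%:Z -> periodic_lattice N 1 b (x, y) -> (x, y) != 0 ->
  b ^+ 2 + 1 <= x ^+ 2 + y ^+ 2.
Proof.
move=> leN /periodic_latticeP[n [k [l [xE yE]]]] v_neq0.
pose m := k * b - l.
have mE : b * x - y = m * N%:Z by rewrite xE yE /m; ring.
have sqr_ge1 (z : int) : z != 0 -> 1 <= z ^+ 2.
  by move=> z_neq0; rewrite -gtz0_ge1 exprn_even_gt0 ?z_neq0 ?orbT.
have [m0|m_neq0] := eqVneq m 0.
  have yb : y = b * x by move: mE; rewrite m0 mul0r; lia.
  have x_neq0 : x != 0.
    by apply: contraNneq v_neq0 => x0; rewrite yb x0 mulr0.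
  have -> : x ^+ 2 + y ^+ 2 = x ^+ 2 * (b ^+ 2 + 1) by rewrite yb; ring.
  by rewrite ler_peMl ?sqr_ge1 // addr_ge0 ?sqr_ge0.
have c_gt0 : 0 < b ^+ 2 + 1 by rewrite ltr_wpDl ?sqr_ge0.
rewrite -(ler_pM2l c_gt0).
(* Lagrange's identity, with [b * x - y] replaced by [m * N]; dropping the square of [x + b * y]
   leaves the Cauchy-Schwarz bound. *)
have -> : (b ^+ 2 + 1) * (x ^+ 2 + y ^+ 2) =
    (m * N%:Z) ^+ 2 + (x + b * y) ^+ 2 by rewrite -mE; ring.
apply: ler_wpDr; first exact: sqr_ge0.
rewrite exprMn; apply: (@le_trans _ _ (N%:Z ^+ 2)).
  by rewrite expr2 ler_pM // ltW.
by rewrite ler_peMl ?sqr_ge1 // sqr_ge0.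
Qed.

Lemma shortest_vectors_periodic_lattice (R : realType) (N : nat) (b : int) :
  b ^+ 2 + 1 <= N%:Z -> shortest_vectors R (periodic_lattice N 1 b) (1, b).
Proof.
move=> leN; split=> // [|[x y] Lv v_neq0].
  by apply/periodic_latticeP; exists 1, 0, 0; rewrite !mul1r !mul0r !addr0.
(* Comparing squared lengths brings the goal back to integers. *)
rewrite /euclidean_length ler_wsqrtr //= -!rmorphXn -!rmorphD ler_int.
by rewrite expr1n addrC; apply: periodic_lattice_sqr_ge Lv v_neq0.
Qed.

Theorem theorem1p3 (R : realType) (N : nat) (a b : int)
    (N_gt0 : (0 < N)%N)
    (a_eq : a = 1)
    (b_eq : b = Num.floor (Num.sqrt (N%:R : R)) - 1) :
  f R N a b =
  Num.sqrt ((Num.floor (Num.sqrt (N%:R : R)) - 1)%:~R ^+ 2 + 1)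
    / Num.sqrt N%:R.
Proof.
pose s := Num.floor (Num.sqrt (N%:R : R)).
have s_ge1 : 1 <= s.
  by rewrite /s floor_ge_int -[leLHS]sqrtr1 ler_wsqrtr // ler1n.
have s2_le : s ^+ 2 <= N%:Z.
  rewrite -(ler_int R) rmorphXn /= -[leRHS](@sqr_sqrtr R) ?ler0n //.
  by rewrite lerXn2r ?nnegrE ?sqrtr_ge0 ?ler0z ?floor_le ?(le_trans _ s_ge1).
(* [(s - 1) ^ 2 + 1 = s ^ 2 - 2 * (s - 1)], which is at most [s ^ 2] since [1 <= s]. *)
have leN : b ^+ 2 + 1 <= N%:Z by rewrite b_eq -/s; nia.
rewrite /f a_eq.
rewrite (shortest_lengthE (shortest_vectors_periodic_lattice R N b leN)).
by rewrite /euclidean_length /= expr1n addrC -b_eq.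
Qed.
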